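(* Let $\mathbf{V}$ be a pseudovariety. Then $\mathbf{V}$ is permutative (in the sense that it satisfies a permutation identity) if and only if $\mathbf{T} \not\subseteq \mathbf{V}$ and $\mathbf{V} \subseteq \mathbf{Perm}$.
   Context: A pseudovariety is a class of finite semigroups closed under finite direct products, subsemigroups and homomorphic images. A permutation identity is an identity $x_1 \cdots x_n \approx x_{1\sigma} \cdots x_{n\sigma}$ with distinct variables $x_1,\dots,x_n$ and $\sigma$ a nontrivial permutation of $\{1,\dots,n\}$ ($i\sigma$ is the image of $i$). A finite semigroup is permutative if it satisfies some permutation identity; a pseudovariety is permutative if there is a single permutation identity satisfied by all its members. $\mathbf{Perm}$ denotes the pseudovariety of all finite permutative semigroups (the permutation identity may vary with the semigroup). $\mathbf{T} = [\![xyx \approx x^2 \approx 0]\!]$ is the pseudovariety of all finite semigroups $S$ with zero in which $xyx = x^2 = 0$ for all $x,y \in S$. *)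

(* Defs.v *)
From HB Require Import structures.
From mathcomp Require Import all_boot.

Set Implicit Arguments.
Unset Strict Implicit.
Unset Printing Implicit Defensive.

Local Open Scope group_scope.

(* Semigroups are nonempty, as usual; the library's semigroupType does not
   require it. *)
HB.mixin Record isNonempty T := {
  nonempty : inhabited T
}.

#[short(type="finSemigroupType")]
HB.structure Definition FinSemigroup :=
  {T of isNonempty T & Semigroup T & Finite T}.

Bind Scope group_scope with FinSemigroup.sort.

(* Loaded only here: Hierarchy Builder refuses to declare FinSemigroup after
   fingroup's FinStarMonoid, of which it is not an ancestor. *)
From mathcomp Require Import fingroup perm.

Section DirectProduct.

Variables (I : finType) (S : I -> finSemigroupType).

Notation prodS := {dffun forall i, S i}.

Definition dffun_mul (f g : prodS) : prodS := [ffun i => f i * g i].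

HB.instance Definition _ := hasMul.Build prodS dffun_mul.

Fact dffun_mulA : associative (@mul prodS).
Proof. by move=> f g h; apply/ffunP=> i; rewrite !ffunE mulgA. Qed.

Lemma dffun_nonempty : inhabited prodS.
Proof.
have x i : exists y : S i, xpredT y by case: (@nonempty (S i)) => y; exists y.
exact: (inhabits [ffun i => xchoose (x i)]).
Qed.

HB.instance Definition _ := Magma_isSemigroup.Build prodS dffun_mulA.
HB.instance Definition _ := isNonempty.Build prodS dffun_nonempty.

End DirectProduct.

(* The product over an empty I, i.e. the trivial semigroup, is included.
   Since a surjective image of a member is a member, V is closed under
   isomorphism, and subsemigroups can be given by embeddings. *)
Record pseudovariety (V : finSemigroupType -> Prop) : Prop := Pseudovariety {
  pv_prod : forall (I : finType) (S : I -> finSemigroupType),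
    (forall i, V (S i)) -> V {dffun forall i, S i};
  pv_sub : forall (S T : finSemigroupType) (f : {multiplicative T -> S}),
    injective f -> V S -> V T;
  pv_img : forall (S T : finSemigroupType) (f : {multiplicative S -> T}),
    (forall y, exists x, f x = y) -> V S -> V T
}.

(* word_prod x = x_0 * (x_1 * ... * (x_(n-1) * x_n)): there is no unit to start
   from, so the last factor takes the place of the default value. *)
Definition word_prod (S : finSemigroupType) (n : nat) (x : 'I_n.+1 -> S) : S :=
  \big[*%g/x ord_max]_(i < n) x (widen_ord (leqnSn n) i).

Definition sat_perm_id (S : finSemigroupType) (n : nat) (s : 'S_n.+1) : Prop :=
  forall x : 'I_n.+1 -> S, word_prod x = word_prod (fun i => x (s i)).

Definition PermV (S : finSemigroupType) : Prop :=
  exists (n : nat) (s : 'S_n.+1), s != 1 /\ sat_perm_id S s.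

Definition permutative (V : finSemigroupType -> Prop) : Prop :=
  exists (n : nat) (s : 'S_n.+1),
    s != 1 /\ forall S : finSemigroupType, V S -> sat_perm_id S s.

Definition is_zero (S : finSemigroupType) (z : S) : Prop :=
  forall x : S, z * x = z /\ x * z = z.

Definition TV (S : finSemigroupType) : Prop :=
  exists z : S, is_zero z /\ forall x y : S, x * y * x = z /\ x * x = z.

Definition class_sub (V W : finSemigroupType -> Prop) : Prop :=
  forall S : finSemigroupType, V S -> W S.

(* Main.v *)
Require Import Defs.
From HB Require Import structures.
From mathcomp Require Import all_boot fingroup perm.
From mathcomp Require Import boolp.

(* A nontrivial permutation identity makes letters commute deep inside words:
   some adjacent x_j x_(j+1) are swapped around in the permuted word, so
   inserting y between them shows that y commutes with blocks of a fixed length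
   r; it then commutes with blocks of r+1 letters as well, hence with single
   letters.
   If V satisfies no permutation identity, then for every k it contains an M
   failing all those of length at most 2k+2.  Suppose M satisfies u = v with u
   a word of n <= k distinct letters.  If v is a rearrangement of u then u = v.
   Otherwise products of n elements of M are products of arbitrarily many
   elements, and the commutation of deep letters in M yields a permutation
   identity of length 2n+2, a contradiction.  So M separates words without
   repeated letters from all other words; as words with a repeated letter have
   value 0 in T, every k-element A in T is a quotient of a subsemigroup of a
   power of M.
   Conversely, the strictly upper triangular matrix units together with 0 form
   a semigroup in T which satisfies no permutation identity of length less than
   its dimension. *)

Set Implicit Arguments.
Unset Strict Implicit.
Unset Printing Implicit Defensive.

Local Open Scope group_scope.

(** * Values of words, in a semigroup with a unit adjoined *)

(** The adjoined unit gives the empty word a value, so words can be cut anywhere. *)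
Definition adjoin1 (S : semigroupType) : Type := option S.

Section Adjoin1.

Variable S : semigroupType.

HB.instance Definition _ := Choice.on (adjoin1 S).

Definition adjoin1_mul (a b : adjoin1 S) : adjoin1 S :=
  match a, b with
  | Some x, Some y => Some (x * y)
  | None, _ => b
  | _, None => a
  end.

Fact adjoin1_mulA : associative adjoin1_mul.
Proof. by case=> [x|] [y|] [z|] //=; rewrite mulgA. Qed.

Fact adjoin1_mul1g : left_id None adjoin1_mul.
Proof. by case. Qed.

Fact adjoin1_mulg1 : right_id None adjoin1_mul.
Proof. by case. Qed.

HB.instance Definition _ :=
  isMonoid.Build (adjoin1 S) adjoin1_mulA adjoin1_mul1g adjoin1_mulg1.

Definition ev (w : seq S) : adjoin1 S := \prod_(x <- w) (Some x : adjoin1 S).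

Lemma ev_nil : ev [::] = 1.
Proof. exact: big_nil. Qed.

Lemma ev_cons x w : ev (x :: w) = (Some x : adjoin1 S) * ev w.
Proof. exact: big_cons. Qed.

Lemma ev_cat u v : ev (u ++ v) = ev u * ev v.
Proof. exact: big_cat. Qed.

Lemma ev_mul2 x y w : ev (x * y :: w) = ev [:: x, y & w].
Proof. by rewrite !ev_cons mulgA. Qed.

Lemma ev_eq1 w : ev w = 1 -> w = [::].
Proof. by case: w => // x w; rewrite ev_cons; case: (ev w). Qed.

End Adjoin1.

(* big_enum asks for a commutative law. *)
Lemma big_index_enum (I : finType) R (idx : R) op (F : I -> R) :
  \big[op/idx]_i F i = \big[op/idx]_(i <- enum I) F i.
Proof. by rewrite enumT [index_enum _]unlock. Qed.

Lemma ev_codom (S : semigroupType) (I : finType) (x : I -> S) :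
  ev (codom x) = \prod_i (Some (x i) : adjoin1 S).
Proof. by rewrite /ev big_map -big_index_enum. Qed.

Lemma word_prod_ev (S : finSemigroupType) n (x : 'I_n.+1 -> S) :
  ev (codom x) = Some (word_prod x).
Proof.
rewrite ev_codom big_ord_recr /= /word_prod.
elim: (index_enum _) => [|i r IHr]; first by rewrite !big_nil.
by rewrite !big_cons -mulgA IHr.
Qed.

Lemma sat_perm_id_prod (S : finSemigroupType) n (s : 'S_n.+1) :
    sat_perm_id S s ->
  forall X : 'I_n.+1 -> adjoin1 S, (forall i, X i != 1) ->
  \prod_i X i = \prod_i X (s i).
Proof.
move=> Ss X X1.
have x i : {y | X i = Some y} by case: (X i) (X1 i) => [y|//]; exists y.
have := congr1 Some (Ss (fun i => sval (x i))).
rewrite -!word_prod_ev !ev_codom.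
have Xx i : X i = Some (sval (x i)) by case: (x i).
by under eq_bigr do rewrite -Xx; under [in RHS]eq_bigr do rewrite -Xx.
Qed.

(** * From permutation identities to commuting letters *)

(** Let [p] be the least moved point, so [s p > p]. The preimage [q] of [s p - 1] is not [p], and it
    is not below [p], where every point is fixed while [s p - 1 >= p]. *)
Lemma perm_descent n (s : 'S_n.+1) :
  s != 1 -> exists p q : 'I_n.+1, p < q /\ s p = (s q).+1 :> nat.
Proof.
move=> s1; have [i0 si0] : exists i, s i != i.
  apply/existsP; apply: contraNT s1 => /existsPn s1.
  by apply/eqP/permP => i; rewrite perm1; apply/eqP/negbNE.
case: (@arg_minnP _ i0 (fun i => s i != i) (fun i => i) si0) => i si imin.
have lt_i_si : i < s i.
  rewrite ltn_neqAle eq_sym si leqNgt; apply: contra si => lt_si_i.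
  have: s (s i) == s i by apply: contraLR lt_si_i; rewrite -leqNgt; apply: imin.
  by rewrite (inj_eq perm_inj).
have lt_j : (s i).-1 < n.+1 by apply: leq_ltn_trans (leq_pred _) (ltn_ord _).
have sq : s (s^-1 (Ordinal lt_j)) = Ordinal lt_j by rewrite permKV.
exists i, (s^-1 (Ordinal lt_j)); rewrite sq /= (ltn_predK lt_i_si); split=> //.
have Dsi := ltn_predK lt_i_si.
have qi : s^-1 (Ordinal lt_j) != i.
  apply: contra_not_neq (negP (negbT (ltnn (s i)))) => qi; rewrite -{1}qi sq /=.
  by rewrite Dsi.
rewrite ltn_neqAle eq_sym qi leqNgt; apply/negP => lt_q_i.
have /eqP : s (s^-1 (Ordinal lt_j)) == s^-1 (Ordinal lt_j).
  by apply: contraLR lt_q_i; rewrite -leqNgt; apply: imin.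
rewrite sq => /(congr1 val) /= E; move: lt_q_i; rewrite -E ltnNge.
by rewrite -ltnS Dsi lt_i_si.
Qed.

Section Insertion.

Variables (G : monoidType) (I : eqType) (k : I) (c : G) (F : I -> G).

Lemma prod_skip r (g : I -> G) : k \notin r ->
  \prod_(i <- r) (if i == k then g i else F i) = \prod_(i <- r) F i.
Proof.
move=> kr; apply: eq_big_seq => i ir.
by case: eqP ir kr => // -> ->.
Qed.

Lemma prod_insertr r : uniq r -> k \in r ->
  \prod_(i <- r) (if i == k then F i * c else F i) =
  \prod_(i <- take (index k r).+1 r) F i *
    (c * \prod_(i <- drop (index k r).+1 r) F i).
Proof.
elim: r => //= j r IHr /andP[jr Ur]; rewrite inE eq_sym big_cons.
case: (eqVneq j k) jr => [-> kr _|_ _ /= kr].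
  by rewrite prod_skip // take0 drop0 big_seq1 !mulgA.
by rewrite big_cons IHr // !mulgA.
Qed.

Lemma prod_insertl r : uniq r -> k \in r ->
  \prod_(i <- r) (if i == k then c * F i else F i) =
  \prod_(i <- take (index k r) r) F i *
    (c * \prod_(i <- drop (index k r) r) F i).
Proof.
elim: r => //= j r IHr /andP[jr Ur]; rewrite inE eq_sym big_cons.
case: (eqVneq j k) jr => [-> kr _|_ _ /= kr].
  by rewrite prod_skip // big_nil mul1g big_cons !mulgA.
by rewrite big_cons IHr // !mulgA.
Qed.

End Insertion.

Section PermutationIdentity.

Variable S : finSemigroupType.

(* Since s p = s q + 1, the letters x_(s q) and x_(s p) are adjacent on the
   left-hand side of the identity, so multiplying x_(s q) by y on the right
   has the same effect as multiplying x_(s p) by y on the left. *)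
Lemma sat_perm_id_shift n (s : 'S_n.+1) (p q : 'I_n.+1) :
    sat_perm_id S s -> s p = (s q).+1 :> nat ->
  forall (w : seq S) y, size w = n.+1 ->
  ev (take p w ++ y :: drop p w) = ev (take q.+1 w ++ y :: drop q.+1 w).
Proof.
move=> Ss spq w y sw.
(* Assigned through [s^-1], the letters spell [w] on the permuted side. *)
pose X i : adjoin1 S := Some (nth y w (s^-1 i)).
pose c : adjoin1 S := Some y.
have memI i : i \in enum 'I_n.+1 by rewrite mem_enum.
have UI : uniq (enum 'I_n.+1) := enum_uniq _.
have Xl : \prod_i (if i == s p then c * X i else X i) =
          \prod_i (if i == s q then X i * c else X i).
  rewrite !big_index_enum prod_insertl // prod_insertr //.
  by rewrite !index_enum_ord spq.
have ev_sub (f : seq 'I_n.+1 -> seq 'I_n.+1) (g : seq S -> seq S) :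
    (forall h : 'I_n.+1 -> S, map h (f (enum 'I_n.+1)) =
      g (map h (enum 'I_n.+1))) ->
    \prod_(i <- f (enum 'I_n.+1)) X (s i) = ev (g w).
  move=> fg; have -> : w = map (fun i : 'I_n.+1 => nth y w i) (enum 'I_n.+1).
    rewrite (map_comp (nth y w) val) val_enum_ord.
    by rewrite -sw map_nth_iota0 ?take_size.
  by rewrite -fg /ev big_map; apply: eq_bigr => i _; rewrite /X permK.
move: Xl; rewrite (sat_perm_id_prod Ss); last by move=> i; case: ifP.
rewrite [in RHS](sat_perm_id_prod Ss); last by move=> i; case: ifP.
rewrite !big_index_enum.
under eq_bigr do rewrite (inj_eq perm_inj).
under [in RHS]eq_bigr do rewrite (inj_eq perm_inj).
rewrite (@prod_insertl _ _ p c (fun i => X (s i))) //.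
rewrite (@prod_insertr _ _ q c (fun i => X (s i))) // !index_enum_ord.
rewrite (ev_sub (take p) (take p)) => [|h]; last by rewrite map_take.
rewrite (ev_sub (take q.+1) (take q.+1)) => [|h]; last by rewrite map_take.
rewrite (ev_sub (drop p) (drop p)) => [|h]; last by rewrite map_drop.
rewrite (ev_sub (drop q.+1) (drop q.+1)) => [|h]; last by rewrite map_drop.
by rewrite !ev_cat !ev_cons.
Qed.

Definition block_commuting a r c := forall (u b v : seq S) y,
  size u = a -> size b = r -> c <= size v ->
  ev (u ++ y :: b ++ v) = ev (u ++ b ++ y :: v).

Lemma sat_perm_id_block n (s : 'S_n.+1) : s != 1 -> sat_perm_id S s ->
  exists a r c, block_commuting a r.+1 c.
Proof.
move=> /perm_descent[p [q [lt_pq spq]]] Ss.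
(* The block fills the positions from [p] to [q] of a word of [n.+1] letters, which leaves [n - q]
   letters behind it. *)
exists p, (q - p), (n - q) => u b v y su sb sv.
have le_qn : q <= n := ltn_ord q.
pose v1 := take (n - q) v; pose v2 := drop (n - q) v.
have sv1 : size v1 = n - q by rewrite size_takel.
have := @sat_perm_id_shift n s p q Ss spq (u ++ b ++ v1) y.
have suq : size (u ++ b) = q.+1 by rewrite size_cat su sb addnS subnKC // ltnW.
rewrite -su take_size_cat // drop_size_cat // catA.
rewrite -suq take_size_cat // drop_size_cat //.
rewrite size_cat suq sv1 addSn subnKC // -!catA => /(_ erefl) E.
rewrite -(cat_take_drop (n - q) v) -/v1 -/v2 catA -cat_cons !catA ev_cat.
by rewrite -!catA E -ev_cat -!catA.
Qed.

(* Commuting y with z_1 ... z_r and with the product of the r factors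
   z_1, ..., z_(r-1), z_r z commutes y with z. *)
Lemma block_commuting_letters a r c : block_commuting a r.+1 c ->
  forall (u v : seq S) y z, a + r.+1 <= size u -> c <= size v ->
  ev (u ++ [:: y, z & v]) = ev (u ++ [:: z, y & v]).
Proof.
move=> H u v y z su sv.
rewrite -(cat_take_drop (size u - (a + r.+1)) u).
set u0 := take _ u; set u' := drop _ u.
have su' : size u' = a + r.+1 by rewrite size_drop subKn.
rewrite -!catA !ev_cat; congr (_ * _); rewrite -!ev_cat.
rewrite -(cat_take_drop a u'); set u1 := take a u'.
have su1 : size u1 = a by rewrite size_takel // su' leq_addr.
case/lastP: (drop a u') (size_drop a u') => [|b x]; rewrite su' addKn //.
rewrite size_rcons => -[sb].
have merge t v' :
    ev (t ++ rcons b (x * z) ++ v') = ev (t ++ rcons b x ++ z :: v').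
  by rewrite !cat_rcons !ev_cat ev_mul2.
have <- : ev (u1 ++ y :: rcons b x ++ z :: v) =
          ev ((u1 ++ rcons b x) ++ [:: y, z & v]).
  by rewrite H ?catA ?size_rcons ?sb // (leq_trans sv) /=.
have := merge (rcons u1 y) v; rewrite ![rcons u1 y ++ _]cat_rcons => <-.
by rewrite H ?size_rcons ?sb // merge -!catA.
Qed.

Lemma PermV_commuting : PermV S -> exists N, forall (u v : seq S) y z,
  N <= size u -> N <= size v ->
  ev (u ++ [:: y, z & v]) = ev (u ++ [:: z, y & v]).
Proof.
move=> [n [s [s1 /(sat_perm_id_block s1)[a [r [c H]]]]]].
exists (a + r.+1 + c) => u v y z su sv.
apply: (block_commuting_letters H); first exact: leq_trans (leq_addr _ _) su.
exact: leq_trans (leq_addl _ _) sv.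
Qed.

End PermutationIdentity.

(** * Separating words without repeated letters from all others *)

Section Separation.

Variable S : finSemigroupType.

(** As the letters of [u] are distinct, every assignment of values to its positions comes from some
    [f]. *)
Lemma sat_perm_id_words (A : eqType) (u v : seq A) :
    uniq u -> perm_eq v u -> v != u ->
    (forall f : A -> S, ev (map f u) = ev (map f v)) ->
  exists n (s : 'S_n.+1), [/\ n < size u, s != 1 & sat_perm_id S s].
Proof.
case Du: u => [|a u'] Uu; first by move/perm_nilP->.
rewrite -Du in Uu *; have su : size u == (size u').+1 by rewrite Du.
pose t := Tuple su; rewrite -[u]/(val t).
move=> /tuple_permP[s Dv] neq_vu uv; exists (size u'), s; split.
- by rewrite size_tuple.
- apply: contraNneq neq_vu => s1; rewrite Dv s1; apply/eqP.
  by rewrite -[RHS]map_tnth_enum; apply: eq_map => i; rewrite perm1.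
move=> x; apply: Some_inj; rewrite -!word_prod_ev.
pose f a := x (inord (index a u)).
have fx i : f (tnth t i) = x i.
  by rewrite /f (tnth_nth a) index_uniq ?size_tuple ?inord_val.
have -> : codom x = map f t.
  rewrite -[X in map f X]map_tnth_enum -map_comp.
  by apply: eq_map => i; rewrite /= fx.
rewrite uv Dv -map_comp; congr ev; apply: eq_map => i.
by rewrite /= fx.
Qed.

(** Rewriting the first [n] letters lengthens the word by at least one, and this can be repeated. *)
Lemma stretch_product n :
    (forall w : seq S, size w = n -> exists2 w', n < size w' & ev w' = ev w) ->
  forall m (w : seq S), n <= size w ->
  exists2 w', m + n <= size w' & ev w' = ev w.
Proof.
move=> grow m w le_nw; elim: m => [|m [w1 le_mw1 <-]]; first by exists w.
have le_nw1 := leq_trans (leq_addl m n) le_mw1.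
have [w2 lt_nw2 ev_w2] := grow (take n w1) (size_takel le_nw1).
exists (w2 ++ drop n w1); last by rewrite ev_cat ev_w2 -ev_cat cat_take_drop.
rewrite size_cat size_drop addSn (leq_ltn_trans le_mw1) //.
by rewrite -[X in X < _](subnKC le_nw1) ltn_add2r.
Qed.

(* A word v that is not a rearrangement of the letters of u either misses a
   letter a of u, and then substituting a * a for a changes the value of u but
   not that of v, or is longer than u. *)
Lemma grow_product (A : eqType) (u v : seq A) : uniq u -> ~~ perm_eq v u ->
    (forall f : A -> S, ev (map f u) = ev (map f v)) ->
  forall w : seq S, size w = size u ->
  exists2 w', size u < size w' & ev w' = ev w.
Proof.
move=> Uu not_uv uv w sw; case: (@nonempty S) => x0.
pose f a := nth x0 w (index a u).
have Dw : map f u = w.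
  apply: (@eq_from_nth _ x0); rewrite size_map // => i lt_iu.
  have b : A by case: (u) lt_iu.
  by rewrite (nth_map b) // /f index_uniq.
have [/allP sub_uv|] := boolP (all (mem v) u).
  exists (map f v); last by rewrite -uv Dw.
  rewrite size_map ltnNge; apply: contra not_uv => le_vu.
  have [eq_s eq_m] := uniq_min_size Uu sub_uv le_vu.
  rewrite perm_sym; apply: uniq_perm => //.
  by rewrite (eq_uniq eq_s eq_m) in Uu.
case/allPn=> a au av; pose f' b := if b == a then f a * f a else f b.
have f'v : map f' v = map f v.
  by apply/eq_in_map => b bv; rewrite /f'; case: eqP bv av => //= -> ->.
have ev_w : ev (map f' u) = ev w by rewrite uv f'v -uv Dw.
have f'a : f' a = f a * f a by rewrite /f' eqxx.
case/splitPr: au f'a Uu ev_w => u1 u2 f'a Uu ev_w.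
exists (map f' u1 ++ [:: f a, f a & map f' u2]).
  by rewrite !size_cat /= !size_map !addnS.
by rewrite -ev_w map_cat /= f'a !ev_cat ev_mul2.
Qed.

Lemma uniq_word_separated (A : eqType) (u v : seq A) :
    PermV S -> uniq u ->
    (forall n (s : 'S_n.+1), n < (size u + size u).+2 -> s != 1 ->
       ~ sat_perm_id S s) ->
    (forall f : A -> S, ev (map f u) = ev (map f v)) ->
  u = v.
Proof.
move=> /PermV_commuting[N comm] Uu not_sat uv; set m := size u in not_sat *.
apply/eqP; rewrite eq_sym; apply: contraT => neq_vu.
have [perm_vu|not_uv] := boolP (perm_eq v u).
  have [n [s [lt_n s1]]] := sat_perm_id_words Uu perm_vu neq_vu uv.
  apply: contraPT => _; apply: not_sat s1.
  by apply: leq_trans lt_n _; rewrite !leqW // leq_addr.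
have grow := stretch_product (grow_product Uu not_uv uv) N.
have stretch (w : seq S) :
    size w = m -> exists2 w', N <= size w' & ev w' = ev w.
  move=> sw; have [|w' le_w' <-] := grow w; first by rewrite sw.
  by exists w' => //; apply: leq_trans le_w'; rewrite leq_addr.
pose l1 := iota 0 m; pose l2 := iota m.+2 m.
have Dl : iota 0 (m + m).+2 = l1 ++ [:: m, m.+1 & l2].
  by rewrite -!addnS iotaD.
(* The middle letters [m] and [m.+1] are exchanged. Each flanking block has [m] letters, so its
   value is also that of a word of length at least [N], and this is enough context for the middle
   letters to commute. *)
have [|||f|n [s [lt_n s1]]] :=
  @sat_perm_id_words _ (iota 0 (m + m).+2) (l1 ++ [:: m.+1, m & l2]).
- exact: iota_uniq.
- by rewrite Dl perm_cat2l (perm_catCA [:: m.+1] [:: m]).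
- by rewrite Dl eqseq_cat // eqxx /= eqseq_cons (gtn_eqF (ltnSn m)).
- rewrite Dl !map_cat /=.
  have [|w1 sw1 ew1] := stretch (map f l1); first by rewrite size_map size_iota.
  have [|w2 sw2 ew2] := stretch (map f l2); first by rewrite size_map size_iota.
  have := comm w1 w2 (f m) (f m.+1) sw1 sw2.
  by rewrite !ev_cat !ev_cons ew1 ew2.
by apply: contraPT => _; apply: not_sat s1; rewrite size_iota in lt_n.
Qed.

End Separation.

(** * Quotients of subsemigroups of powers *)

Section Projection.

Variables (I : finType) (S : I -> finSemigroupType).

Lemma word_prod_proj n (X : 'I_n.+1 -> {dffun forall i, S i}) i :
  (word_prod X : {dffun forall i, S i}) i = word_prod (fun k => X k i).
Proof.
rewrite /word_prod; elim: (index_enum _) => [|k r IHr].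
  by rewrite !big_nil.
by rewrite !big_cons ffunE IHr.
Qed.

(** Elements of one factor lift to the product by fixing an arbitrary [g] in the other
    coordinates. *)
Lemma sat_perm_id_proj n (s : 'S_n.+1) i :
  sat_perm_id {dffun forall i, S i} s -> sat_perm_id (S i) s.
Proof.
move=> Ps x; case: (dffun_nonempty S) => g.
pose X k : {dffun forall i, S i} := [ffun j => dfwith g (x k) j].
have -> : x = fun k => X k i by apply/funext => k; rewrite ffunE dfwith_in.
by rewrite -!word_prod_proj (Ps X).
Qed.

End Projection.

(** A repeated letter [x] produces a factor [x * y * x], or [x * x] if the two occurrences are
    adjacent. *)
Lemma not_uniq_TV (S : finSemigroupType) (z : S) (w : seq S) : is_zero z ->
  (forall x y : S, x * y * x = z /\ x * x = z) -> ~~ uniq w -> ev w = Some z.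
Proof.
move=> z0 Sz; have ev_z v : (Some z : adjoin1 S) * ev v = Some z.
  by case: (ev v) => [x|] //; congr Some; case: (z0 x).
elim: w => //= x w IHw; rewrite negb_and negbK => /orP[/splitPr[w1 w2]|/IHw ew].
  rewrite ev_cons ev_cat ev_cons !mulgA -[RHS](ev_z w2); congr (_ * _).
  by case: (ev w1) => [y|]; congr Some; [case: (Sz x y)|case: (Sz x x)].
by rewrite ev_cons ew; congr Some; case: (z0 x).
Qed.

Section Relation.

Variables (A M : finSemigroupType).

Definition word_values : Type := (A * {dffun forall f : {ffun A -> M}, M})%type.

HB.instance Definition _ := Finite.on word_values.
HB.instance Definition _ := Semigroup.on word_values.

(** This is the subsemigroup generated by the pairs of a letter [a] and the family of all [f a].
    Once its second projection is injective, its surjective first projection makes [A] a quotient of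
    a subsemigroup of a power of [M]. *)
Definition word_graph : {pred word_values} := fun ap => `[< exists w : seq A,
  ev w = Some ap.1 /\ forall f : {ffun A -> M}, ev (map f w) = Some (ap.2 f) >].

Fact word_graph_mul : mulg_closed word_graph.
Proof.
move=> [a p] [b q] /asboolP[u [/= ua up]] /asboolP[v [/= vb vq]].
apply/asboolP; exists (u ++ v); split=> [|f] /=; first by rewrite ev_cat ua vb.
by rewrite map_cat ev_cat up vq ffunE.
Qed.

Definition word_rel := {ap : word_values | word_graph ap}.

HB.instance Definition _ := Finite.on word_rel.
HB.instance Definition _ := SubType.on word_rel.
HB.instance Definition _ :=
  SubChoice_isSubSemigroup.Build word_values word_graph word_rel
    word_graph_mul.

Lemma word_graph_letter a : word_graph (a, [ffun f : {ffun A -> M} => f a]).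
Proof.
apply/asboolP; exists [:: a].
by split=> [|f] /=; rewrite ev_cons ev_nil mulg1 ?ffunE.
Qed.

Definition word_rel_letter a : word_rel :=
  exist _ (a, [ffun f : {ffun A -> M} => f a]) (word_graph_letter a).

Fact word_rel_nonempty : inhabited word_rel.
Proof. by case: (@nonempty A) => a; exact: inhabits (word_rel_letter a). Qed.

HB.instance Definition _ := isNonempty.Build word_rel word_rel_nonempty.

Definition word_rel_fst (x : word_rel) : A := (val x).1.

Definition word_rel_snd (x : word_rel) : {dffun forall f : {ffun A -> M}, M} :=
  (val x).2.

HB.instance Definition _ :=
  isMultiplicative.Build word_rel A word_rel_fst (fun _ _ => erefl).
HB.instance Definition _ :=
  isMultiplicative.Build word_rel {dffun forall f : {ffun A -> M}, M}
    word_rel_snd (fun _ _ => erefl).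

Lemma word_rel_fst_surj a : exists x, word_rel_fst x = a.
Proof. by exists (word_rel_letter a). Qed.

(** Two words with the same values in [M] are equal if one of them has no repeated letter; otherwise
    both have value zero in [A]. *)
Lemma word_rel_snd_inj : TV A ->
    (forall u v : seq A, uniq u ->
      (forall f : A -> M, ev (map f u) = ev (map f v)) -> u = v) ->
  injective word_rel_snd.
Proof.
move=> [z [z0 Az]] sep [[a p] ap] [[b q] bq]; rewrite /word_rel_snd /= => Epq.
apply/val_inj => /=; rewrite {}Epq in ap *; congr (_, _); apply: Some_inj.
have /asboolP[u [/= <- uq]] := ap; have /asboolP[v [/= <- vq]] := bq.
have uv (f : A -> M) : ev (map f u) = ev (map f v).
  have Df : f =1 [ffun x => f x] by move=> x; rewrite ffunE.
  by rewrite !(eq_map Df) uq vq.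
have [Uu|nUu] := boolP (uniq u); first by rewrite (sep u v).
have [Uv|nUv] := boolP (uniq v); first by rewrite (sep v u).
by rewrite !(not_uniq_TV z0 Az).
Qed.

End Relation.

(** * A semigroup of matrix units in T *)

(* Some (i, j) with i < j is the matrix unit e_(i,j) and None is 0; a pair with
   j <= i is an element whose products all vanish. *)
Definition strict_interval (m : nat) : Type := option ('I_m * 'I_m).

Section StrictInterval.

Variable m : nat.

HB.instance Definition _ := Finite.on (strict_interval m).

Definition strict_interval_mul (x y : strict_interval m) : strict_interval m :=
  if x is Some (i, j) then
    if y is Some (k, l) then
      if [&& j == k, i < j & k < l] then Some (i, l) else None
    else None
  else None.

Fact strict_interval_mulA : associative strict_interval_mul.
Proof.
case=> [[i j]|] [[k l]|] [[p q]|] //=; try by case: ifP.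
case: (eqVneq j k) => [<-|] /=; last first.
  by case: ifP => //= /and3P[/eqP-> _ _] /negbTE->.
case: (eqVneq l p) => [<-|] /=; last by case: ifP => //= _ /negbTE ->.
case: (ltnP i j) => ij; case: (ltnP j l) => jl; case: (ltnP l q) => lq;
  by rewrite /= ?eqxx /= ?(ltn_trans ij jl) ?(ltn_trans jl lq) ?lq ?ij
             ?[l < q]ltnNge ?lq ?[i < j]ltnNge ?ij ?andbF.
Qed.

HB.instance Definition _ :=
  isSemigroup.Build (strict_interval m) strict_interval_mulA.
HB.instance Definition _ :=
  isNonempty.Build (strict_interval m) (inhabits None).

Lemma strict_interval_TV : TV (strict_interval m).
Proof.
exists None; split=> [[[i j]|]|[[i j]|] [[k l]|]] //=; split=> //.
- rewrite /mul /=; case: ifP => // /and3P[/eqP<- ij jl] /=.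
  case: ifP => // /and3P[/eqP Dl _ _].
  by move: (ltn_trans ij jl); rewrite Dl ltnn.
- by rewrite /mul /=; case: ifP => // /and3P[/eqP<- ]; rewrite ltnn.
- by rewrite /mul /=; case: ifP => // /and3P[/eqP<- ]; rewrite ltnn.
Qed.

End StrictInterval.

Section StrictIntervalWords.

Variable n : nat.

(** The superdiagonal unit e_(i,i+1): [widen_ord] keeps the index and [lift ord0] raises it by
    one. *)
Definition unit_interval (i : 'I_n.+1) : strict_interval n.+2 :=
  Some (widen_ord (leqnSn n.+1) i, lift ord0 i).

Lemma ev_unit_interval_iota l i k : map val l = iota i k.+1 ->
  exists i' j' : 'I_n.+2,
  [/\ ev (map unit_interval l) = Some (Some (i', j')),
      i' = i :> nat & j' = i + k.+1 :> nat].
Proof.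
elim: k i l => [|k IHk] i [|a l] //= [Da].
  case: l => // _; exists (widen_ord (leqnSn n.+1) a), (lift ord0 a).
  by rewrite ev_cons ev_nil mulg1 /= /bump addn1 -Da.
move=> /(IHk i.+1 l)[i' [j' [El Di Dj]]].
exists (widen_ord (leqnSn n.+1) a), j'; rewrite Dj addSnnS; split=> //.
rewrite ev_cons El; congr Some; rewrite /mul /=.
rewrite -val_eqE /= /bump leq0n add1n Di Dj Da eqxx ltnSn.
by rewrite addnS ltnS leq_addr.
Qed.

(** In a nonzero product each unit must start at the index where the previous one ends, so the value
    determines the word. *)
Lemma ev_unit_interval l (i j : 'I_n.+2) :
  ev (map unit_interval l) = Some (Some (i, j)) -> map val l = iota i (j - i).
Proof.
elim: l i j => [|a l IHl] i j /=; first by rewrite ev_nil.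
rewrite ev_cons.
case E: (ev (map unit_interval l)) => [[[k j']|]|] //.
  case; rewrite /mul /=; case: ifP => // /and3P[/eqP Dk _ lt_kj] [<- Dj].
  rewrite {}Dj in E lt_kj; rewrite (IHl _ _ E) -Dk /= /bump leq0n add1n.
  rewrite -Dk /= /bump leq0n add1n in lt_kj.
  by rewrite -[j - a]prednK ?subn_gt0 ?(ltnW lt_kj) //= subnS.
move/ev_eq1: E => /eqP; rewrite -size_eq0 size_map size_eq0 => /eqP-> [<- <-].
by rewrite /= /bump subSn // subnn.
Qed.

Lemma strict_interval_not_sat (s : 'S_n.+1) :
  sat_perm_id (strict_interval n.+2) s -> s = 1.
Proof.
move=> /(_ unit_interval) Es; have := congr1 Some Es.
rewrite -!word_prod_ev => E.
have := @ev_unit_interval_iota (enum 'I_n.+1) 0 n (val_enum_ord _).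
case=> i [j [Eij Di Dj]]; move: Eij; rewrite E.
have -> : codom (fun i => unit_interval (s i)) =
          map unit_interval (map s (enum 'I_n.+1)).
  by rewrite -map_comp.
move/ev_unit_interval; rewrite Di Dj subn0 -val_enum_ord => /(inj_map val_inj).
rewrite -[RHS]map_id => /eq_in_map s_id.
by apply/permP => k; rewrite perm1 s_id // mem_enum.
Qed.

End StrictIntervalWords.

(** * The two directions of the equivalence *)

Lemma class_sub_TV (V : finSemigroupType -> Prop) : pseudovariety V ->
  class_sub V PermV -> ~ permutative V -> class_sub TV V.
Proof.
move=> pvV VP notP A TA.
have fails (p : {n & 'S_n.+1}) :
    exists S, V S /\ (tagged p != 1 -> ~ sat_perm_id S (tagged p)).
  case: p => n s /=; apply: contrapT => /forallNP noS; apply: notP; exists n, s.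
  case: (eqVneq s 1) noS => [-> noS|s1 noS].
    (* For [s = 1] any member of [V] will do, and the empty product is one. *)
    pose S0 (i : void) : finSemigroupType := match i with end.
    case: (noS {dffun forall i, S0 i}); split; last by case/eqP.
    by apply: pv_prod => // -[].
  split=> // S VS; apply: contrapT => nS; exact: noS (conj VS (fun=> nS)).
have [S VS] := choice fails.
(* Only finitely many identities have at most [2 * #|A| + 2] letters, so the product of their
   counterexamples is a finite semigroup failing every nontrivial one. *)
pose I := {n : 'I_(#|A| + #|A|).+2 & 'S_n.+1}.
pose F (i : I) := S (Tagged (fun n => 'S_n.+1) (tagged i)).
pose M : finSemigroupType := {dffun forall i, F i}.
have VM : V M.
  apply: pv_prod => // i.
  by case: (VS (Tagged (fun n => 'S_n.+1) (tagged i))).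
have sep (u v : seq A) : uniq u ->
    (forall f : A -> M, ev (map f u) = ev (map f v)) -> u = v.
  move=> Uu; apply: uniq_word_separated => //; first exact: VP.
  move=> n s lt_n s1 Ms.
  have le_u : size u <= #|A| by rewrite -(card_uniqP Uu) max_card.
  have lt_n' : n < (#|A| + #|A|).+2.
    by rewrite (leq_trans lt_n) // !ltnS leq_add.
  pose i : I := Tagged (fun n : 'I_(#|A| + #|A|).+2 => 'S_n.+1)
                       (s : 'S_(Ordinal lt_n').+1).
  have [_ /(_ s1)] := VS (Tagged (fun n => 'S_n.+1) s); apply.
  exact: (@sat_perm_id_proj _ F n s i).
apply: (pv_img pvV (f := @word_rel_fst A M)) (@word_rel_fst_surj A M) _.
apply: (pv_sub pvV (f := @word_rel_snd A M)) (word_rel_snd_inj TA sep) _.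
exact: pv_prod.
Qed.

Theorem theoremC (V : finSemigroupType -> Prop) (pvV : pseudovariety V) :
  permutative V <-> ~ class_sub TV V /\ class_sub V PermV.
Proof.
split=> [[n [s [s1 Vs]]]|[notT VP]]; last first.
  by apply: contrapT => notP; apply: notT; apply: class_sub_TV.
split=> [TV_V|S VS]; last by exists n, s; split=> //; apply: Vs.
(* Dimension [n.+2] has exactly [n.+1] superdiagonal units, one for each variable of the
   identity. *)
have := Vs _ (TV_V _ (strict_interval_TV n.+2)).
by move/strict_interval_not_sat => E; rewrite E eqxx in s1.
Qed.
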